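(* Let $(X_i,d_i,\mu_i)$ and $(Y_i,\rho_i,\nu_i)$, $i=1,\dots,n$, be spaces of homogeneous type, let $\Omega\subset\prod_{i=1}^n X_i$ and $\Omega'\subset\prod_{i=1}^n Y_i$ be measurable sets, and let $P=(p_1,\dots,p_n)$ with $1\le p_i<\infty$. Let $\varphi:\Omega\to\Omega'$ be a measurable mapping of the form $$\varphi(x)=(\psi_1(x_1),\psi_2(x_1,x_2),\dots,\psi_n(x_1,\dots,x_n)),$$ where for each $i<n$ the mapping $\psi_i(x_1,\dots,x_{i-1},\cdot)$ is injective for every fixed $(x_1,\dots,x_{i-1})$ (no injectivity is required for $i=n$). Assume that for each $i=1,\dots,n$ and for $\mu_1\times\dots\times\mu_{i-1}$-a.e. $(x_1,\dots,x_{i-1})$ the mapping $\psi_i(x_1,\dots,x_{i-1},\cdot)$ has the Luzin $\mathcal N^{-1}$-property, and let $J(\psi_i^{-1}(y_1,\dots,y_{i-1},\cdot);y_i)$ be the Radon--Nikodym derivatives defined in the context. Then $\varphi$ induces a bounded composition operator $$C_\varphi:L_P(\Omega')\to L_P(\Omega),\qquad C_\varphi f=f\circ\varphi,$$ if and only if $$\operatorname*{ess\,sup}_{y\in\Omega'}\ \prod_{i=1}^n J(\psi_i^{-1}(y_1,\dots,y_{i-1},\cdot);y_i)^{\frac1{p_i}}<\infty .$$ Moreover, in this case the norm of the operator is $$\|C_\varphi\|=\operatorname*{ess\,sup}_{y\in\Omega'}\ \prod_{i=1}^n J(\psi_i^{-1}(y_1,\dots,y_{i-1},\cdot);y_i)^{\frac1{p_i}}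 .$$
   Context: Space of homogeneous type: a metric space $(X,d)$ with a Borel measure $\mu$ that is doubling, i.e. there is a constant $c$ with $0<\mu(B(x,2r))\le c\,\mu(B(x,r))<\infty$ for all $x\in X$, $r>0$. Mixed norm space: for measurable $\Omega\subset\prod_{i=1}^n X_i$, $L_P(\Omega)$ is the set of measurable functions $f$ (modulo a.e. equality) with finite norm $$\|f\|_{L_P(\Omega)}=\bigg(\int_{X_1}\bigg(\cdots\bigg(\int_{X_n}|f(x)|^{p_n}\chi_\Omega(x)\,d\mu_n\bigg)^{\frac{p_{n-1}}{p_n}}\cdots\bigg)^{\frac{p_1}{p_2}}d\mu_1\bigg)^{\frac1{p_1}};$$ similarly for $L_P(\Omega')$ with $Y_i,\nu_i$. Bounded composition operator: $\varphi$ induces a bounded composition operator if $f\circ\varphi\in L_P(\Omega)$ and $\|f\circ\varphi\|_{L_P(\Omega)}\le K\|f\|_{L_P(\Omega')}$ for every $f\in L_P(\Omega')$, with $K$ independent of $f$; $\|C_\varphi\|$ is the operator norm. Luzin $\mathcal N^{-1}$-property: the preimage of every set of measure zero has measure zero (here with respect to $\nu_i$ on $Y_i$ and $\mu_i$ on $X_i$). Domains: $\psi_i(x_1,\dots,x_{i-1},\cdot)$ is defined on the set of $x_i\in X_i$ such that $(x_1,\dots,x_i)$ is the initial segment of some point of $\Omega$. Radon--Nikodym derivatives: given $(y_1,\dots,y_{i-1})$, by injectivity there is at most one $(x_1,\dots,x_{i-1})$ (initial segment of a point of $\Omega$) with $\psi_j(x_1,\dots,x_j)=y_j$ for all $j<i$.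 For measurable $E\subset Y_i$ put $$\psi_i^{-1}(y_1,\dots,y_{i-1},E)=\{x_i:\ \psi_i(x_1,\dots,x_{i-1},x_i)\in E\}$$ for that $(x_1,\dots,x_{i-1})$ (and the empty set if it does not exist). By the Luzin $\mathcal N^{-1}$-property the measure $E\mapsto\mu_i(\psi_i^{-1}(y_1,\dots,y_{i-1},E))$ is absolutely continuous with respect to $\nu_i$, and $J(\psi_i^{-1}(y_1,\dots,y_{i-1},\cdot);y_i)$ is the nonnegative Radon--Nikodym derivative, i.e. $$\mu_i(\psi_i^{-1}(y_1,\dots,y_{i-1},E))=\int_E J(\psi_i^{-1}(y_1,\dots,y_{i-1},\cdot);y_i)\,d\nu_i(y_i)$$ for all measurable $E\subset Y_i$ and $\nu_1\times\dots\times\nu_{i-1}$-a.e. $(y_1,\dots,y_{i-1})$. As a standing assumption, these derivatives exist as finite-valued functions and are jointly measurable in $(y_1,\dots,y_i)$. The essential supremum over $\Omega'$ is with respect to $\nu_1\times\dots\times\nu_n$. *)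

(* Defs.v *)
From HB Require Import structures.
From mathcomp Require Import all_boot all_order all_algebra.
From mathcomp Require Import all_classical all_reals all_analysis.
From mathcomp Require Import ess_sup_inf.

Set Implicit Arguments.
Unset Strict Implicit.
Unset Printing Implicit Defensive.

Import Order.TTheory GRing.Theory Num.Theory.
Import numFieldNormedType.Exports.

Local Open Scope classical_set_scope.
Local Open Scope ring_scope.

#[short(type="pmetricType")]
HB.structure Definition PointedMetric (R : numDomainType) :=
  {T of Pointed T & Metric R T}.

Notation borel T := (g_sigma_algebraType (@open T)).

Record homogSpace (R : realType) := HomogSpace {
  hs_metric : pmetricType R ;
  hs_borel_measure : {measure set (borel hs_metric) -> \bar R} ;
  (* [ball x r] is the open ball *)
  hs_doubling : exists c : R, forall (x : hs_metric) (r : R), 0 < r ->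
    [/\ (0 < hs_borel_measure (ball x (2 * r)))%E,
        (hs_borel_measure (ball x (2 * r)) <= c%:E * hs_borel_measure (ball x r))%E
      & (c%:E * hs_borel_measure (ball x r) < +oo)%E] }.

Definition hs_sort {R : realType} (S : homogSpace R) : measurableType _ :=
  borel (hs_metric S).
Coercion hs_sort : homogSpace >-> Measurable.type.

Definition hs_measure {R : realType} (S : homogSpace R) : set S -> \bar R :=
  hs_borel_measure S.
Arguments hs_measure {R} S _.
HB.instance Definition _ (R : realType) (S : homogSpace R) :=
  Measure.on (hs_measure S).

Lemma metric_ball_open (R : realType) (T : pmetricType R) (x : T) (r : R) :
  open (ball x r).
Proof.
rewrite openE => y; rewrite ballEmdist /= => xyr.
apply/nbhs_ballP; exists (r - mdist x y) => /=; first by rewrite subr_gt0.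
move=> z; rewrite !ballEmdist /= => yz.
by rewrite (le_lt_trans (metric_triangle x y z))// -ltrBrDl.
Qed.

Lemma measurable_metric_ball (R : realType) (T : pmetricType R) (x : T)
  (r : R) : measurable (ball x r : set (borel T)).
Proof. by apply: sub_sigma_algebra; exact: metric_ball_open. Qed.

Lemma hs_sigma_finite (R : realType) (S : homogSpace R) :
  sigma_finite setT (hs_measure S).
Proof.
have [c Hc] := hs_doubling S.
exists (fun k : nat => ball (point : hs_metric S) (2 * k.+1%:R)).
  apply/seteqP; split => // y _; exists (Num.truncn (mdist point y)) => //.
  rewrite ballEmdist /= (lt_le_trans (truncnS_gt _))//.
  by rewrite ler_peMl// ler1n.
move=> k; split; first exact: measurable_metric_ball.
have [_ h1 h2] := Hc point k.+1%:R (ltr0Sn _ _).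
exact: le_lt_trans h1 h2.
Qed.

HB.instance Definition _ (R : realType) (S : homogSpace R) :=
  Measure_isSigmaFinite.Build _ _ _ (hs_measure S) (hs_sigma_finite S).

(* A finite family of spaces is given as a sequence [X 0, X 1, ...] of which
   only the first [n] terms are used; [initprod X k] is X_0 x ... x X_(k-1), as
   a left-nested binary product, so that a point of [initprod X k.+1] is a pair
   of an initial segment and a last coordinate. *)
Section initprod.
Context {R : realType} (X : nat -> homogSpace R).

Fixpoint initprod_disp (k : nat) : measure_display :=
  if k is j.+1 then
    measure_prod_display
      (initprod_disp j, sigma_display (@open (hs_metric (X j))))
  else default_measure_display.

Fixpoint initprod (k : nat) : measurableType (initprod_disp k) :=
  match k return measurableType (initprod_disp k) with
  | 0 => unit
  | j.+1 => (initprod j * X j)%type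
  end.

Fixpoint initprod_measure (k : nat) : {measure set (initprod k) -> \bar R} :=
  match k return {measure set (initprod k) -> \bar R} with
  | 0 => @dirac _ unit tt R
  | j.+1 => (initprod_measure j \x hs_measure (X j))%E
  end.

Fixpoint segment (s : forall i, X i) (k : nat) : initprod k :=
  match k return initprod k with
  | 0 => tt
  | j.+1 => (segment s j, s j)
  end.

(* The initial segments of length [k <= n] of the points of [Omega]. Points of
   [initprod n] are extended to infinite sequences, so that no cast is needed;
   the terms of index >= n are irrelevant. *)
Definition segments (n : nat) (Omega : set (initprod n)) (k : nat) :
    set (initprod k) :=
  [set segment s k | s in [set s | Omega (segment s n)]].
#[global] Arguments segments {n} Omega k _.

Definition fiber (n : nat) (Omega : set (initprod n)) (i : nat)
    (x : initprod i) : set (X i) :=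
  [set t | segments Omega i.+1 (x, t)].

(* int_(X_0) ( ... (int_(X_(k-1)) F)^(p_(k-2) / p_(k-1)) ... )^(1 / p_0) *)
Fixpoint iterated_integral (p : nat -> R) (k : nat) :
    (initprod k -> \bar R) -> \bar R :=
  match k return (initprod k -> \bar R) -> \bar R with
  | 0 => fun F => F tt
  | j.+1 => fun F => iterated_integral p (fun x : initprod j =>
      poweR (\int[hs_measure (X j)]_t F (x, t))%E
            ((if j is l.+1 then p l else 1) / p j))
  end.

Definition mixed_norm (p : nat -> R) (n : nat) (Omega : set (initprod n))
    (f : initprod n -> R) : \bar R :=
  iterated_integral p (fun x => (`|f x| `^ p n.-1 * \1_Omega x)%:E).

(* Functions are not quotiented by a.e. equality; only their values on [Omega]
   matter. *)
Definition mixed_Lp (p : nat -> R) (n : nat) (Omega : set (initprod n)) :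
    set (initprod n -> R) :=
  [set f | measurable_fun Omega f /\ (mixed_norm p Omega f < +oo)%E].

End initprod.

(* [S] belongs to the completion of the sigma-algebra with respect to [mu], and
   its completed measure is [v]. *)
Definition has_measure {d} {T : measurableType d} {R : realType}
    (mu : {measure set T -> \bar R}) (S : set T) (v : \bar R) : Prop :=
  exists A : set T, [/\ measurable A, mu.-negligible (S `+` A) & mu A = v].

Definition luzin_Ninv {d1 d2} {S : measurableType d1} {T : measurableType d2}
    {R : realType} (mu : {measure set S -> \bar R})
    (nu : {measure set T -> \bar R}) (D : set S) (g : S -> T) : Prop :=
  forall E : set T, nu.-negligible E -> mu.-negligible (D `&` g @^-1` E).

Section triangular.
Context {R : realType} (X Y : nat -> homogSpace R).
(* Only the values of [psi i x] on [fiber Omega x] are meaningful. *)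
Variable psi : forall i, initprod X i -> X i -> Y i.

Fixpoint triangular (k : nat) : initprod X k -> initprod Y k :=
  match k return initprod X k -> initprod Y k with
  | 0 => fun x => x
  | j.+1 => fun x => (triangular x.1, psi x.1 x.2)
  end.

#[global] Arguments triangular {k} _.

(* When the maps [psi j x] with j < i are injective on their domains, at most
   one [x] qualifies, and the set is empty if there is none. *)
Definition psi_inv (n : nat) (Omega : set (initprod X n)) (i : nat)
    (y : initprod Y i) (E : set (Y i)) : set (X i) :=
  [set t | exists x : initprod X i,
     [/\ segments Omega i x, triangular x = y, fiber Omega x t
       & E (psi x t)]].

Definition is_RN_derivative (n : nat) (Omega : set (initprod X n)) (i : nat)
    (J : initprod Y i -> Y i -> R) : Prop :=
  [/\ measurable_fun [set: initprod Y i.+1]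
        (fun y : initprod Y i.+1 => J y.1 y.2),
      forall y t, 0 <= J y t
    & {ae initprod_measure Y i, forall y, forall E, measurable E ->
        has_measure (hs_measure (X i)) (psi_inv Omega y E)
          (\int[hs_measure (Y i)]_(t in E) (J y t)%:E)%E}].

End triangular.

Fixpoint jacobian_prod {R : realType} (Y : nat -> homogSpace R)
    (J : forall i, initprod Y i -> Y i -> R) (p : nat -> R) (k : nat) :
    initprod Y k -> R :=
  match k return initprod Y k -> R with
  | 0 => fun=> 1
  | j.+1 => fun y => jacobian_prod J p y.1 * J j y.1 y.2 `^ (p j)^-1
  end.
Arguments jacobian_prod {R Y} J p {k} _.

(* The essential supremum over [D] of a nonnegative function; multiplying by
   the indicator makes it 0, not -oo, when [D] is a null set. *)
Definition ess_sup_on {d} {T : measurableType d} {R : realType}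
    (mu : {measure set T -> \bar R}) (D : set T) (g : T -> R) : \bar R :=
  ess_sup mu (fun x => (g x * \1_D x)%:E).

Section composition.
Context {R : realType} (X Y : nat -> homogSpace R) (p : nat -> R) (n : nat).
Variables (Omega : set (initprod X n)) (Omega' : set (initprod Y n)).
Variable phi : initprod X n -> initprod Y n.

Definition bounded_composition : Prop :=
  exists K : R, forall f, mixed_Lp p Omega' f ->
    mixed_Lp p Omega (f \o phi) /\
    (mixed_norm p Omega (f \o phi) <= K%:E * mixed_norm p Omega' f)%E.

Definition composition_norm : \bar R :=
  ereal_sup [set mixed_norm p Omega (f \o phi) |
    f in [set f | mixed_Lp p Omega' f /\ (mixed_norm p Omega' f <= 1)%E]].

End composition.

(* Main.v *)
Require Import Defs.
From HB Require Import structures.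
From mathcomp Require Import all_boot all_order all_algebra.
From mathcomp Require Import all_classical all_reals all_analysis.
From mathcomp Require Import measurable_realfun ess_sup_inf.

Set Implicit Arguments.
Unset Strict Implicit.
Unset Printing Implicit Defensive.

Import Order.TTheory GRing.Theory Num.Theory.
Import numFieldNormedType.Exports.

Local Open Scope classical_set_scope.
Local Open Scope ring_scope.

(* Change of variables, one coordinate at a time from the innermost integral
   outwards, gives |f o phi|_(L_P(Omega)) = |f Jp|_(L_P(Omega')), where
   Jp = prod_i J_i^(1/p_i): each new Jacobian factor J_i^(1/p_i) is constant for
   the integrals over y_(i+1), ..., and so moves inside them. Hence C_phi has
   the norm of the multiplication operator by Jp, which is the essential
   supremum of Jp, as normalized indicators of {Jp > c} intersected with a box
   show.

   The initial segments of points of Omega need not form measurable sets, so the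
   exceptional sets on the X side are negligible only iteratedly (for a.e. x_0,
   for a.e. x_1, ...), which is all that iterated integrals see. *)

(** * Integration against a density and change of variables *)

Lemma measurable_subgraph {d} {T : measurableType d} {R : realType}
    (J : T -> R) : measurable_fun setT J ->
  measurable [set z : T * measurableTypeR R | 0 <= z.2 < J z.1].
Proof.
move=> mJ.
have m1 : measurable_fun setT (fun z : T * measurableTypeR R => z.2 : R).
  exact: measurable_snd.
have m2 : measurable_fun setT (fun z : T * measurableTypeR R => J z.1).
  exact: measurableT_comp.
have := measurable_and (measurable_fun_ler (measurable_cst (0 : R)) m1)
  (measurable_fun_ltr m1 m2).
by move=> /(_ measurableT [set true] I); rewrite setTI.
Qed.

(** By Tonelli: the section of the region over [t] is the interval [0, J t), of length [J t]. This
    trades the density [J] for a product measure, on which image measures can be compared. *)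
Lemma integral_subgraph {d} {T : measurableType d} {R : realType}
    (nu : {sigma_finite_measure set T -> \bar R}) (J : T -> R)
    (H : T -> \bar R) :
  measurable_fun setT J -> (forall t, 0 <= J t) ->
  measurable_fun setT H -> (forall t, (0 <= H t)%E) ->
  (\int[nu \x (@lebesgue_measure R)]_z
     (H z.1 * (\1_[set z : T * measurableTypeR R | 0 <= z.2 < J z.1]%R z)%:E)
   = \int[nu]_t (H t * (J t)%:E))%E.
Proof.
move=> mJ J0 mH H0; have mU := measurable_subgraph mJ.
set U := [set z : T * measurableTypeR R | 0 <= z.2 < J z.1] in mU *.
rewrite fubini_tonelli1; last 2 first.
- apply: emeasurable_funM; first exact: measurableT_comp.
  by apply/measurable_EFinP; exact: measurable_indic.
- by move=> z; rewrite mule_ge0.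
apply: eq_integral => t _; rewrite /fubini_F/=.
rewrite ge0_integralZl//; last first.
  apply/measurable_EFinP.
  exact: (measurableT_comp (measurable_indic mU) (pair1_measurable t)).
congr (_ * _)%E.
rewrite (_ : (fun y => (\1_U (t, y))%:E) =
   (fun y => (\1_(`[0, J t[%classic : set R) y)%:E)); last first.
  apply/funext => y; rewrite !indicE.
  suff -> : ((t, y) \in U) = (y \in (`[0, J t[%classic : set R)) by [].
  by apply/idP/idP; rewrite !inE.
rewrite integral_indic// setIT [LHS](lebesgue_measure_itv `[0, J t[)/= lte_fin.
case: ltP => [_|Jt0]; first by rewrite oppr0 adde0.
by congr EFin; apply/eqP; rewrite eq_le J0 Jt0.
Qed.

(* Both integrals are integrals of the identity of [\bar R] against image
   measures, the second one of [nu] times the Lebesgue measure on the region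
   below the graph of [J]; these two image measures agree off 0. *)
Lemma integral_density_transfer {d1 d2} {S : measurableType d1}
    {T : measurableType d2} {R : realType} (mu : {measure set S -> \bar R})
    (nu : {sigma_finite_measure set T -> \bar R}) (J : T -> R)
    (F : S -> \bar R) (H : T -> \bar R) :
  measurable_fun setT J -> (forall t, 0 <= J t) ->
  measurable_fun setT F -> (forall x, (0 <= F x)%E) ->
  measurable_fun setT H -> (forall t, (0 <= H t)%E) ->
  (forall B, measurable B -> ~ B 0%E ->
    mu (F @^-1` B) = (\int[nu]_(t in H @^-1` B) (J t)%:E)%E) ->
  (\int[mu]_x F x = \int[nu]_t (H t * (J t)%:E))%E.
Proof.
move=> mJ J0 mF F0 mH H0 FH.
rewrite -integral_subgraph//; have mU := measurable_subgraph mJ.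
set m2 := (nu \x _)%E.
pose U := [set z : T * measurableTypeR R | 0 <= z.2 < J z.1].
pose K z := (H z.1 * (\1_U z)%:E)%E.
have mK : measurable_fun setT K.
  apply: emeasurable_funM; first exact: measurableT_comp.
  by apply/measurable_EFinP; exact: measurable_indic.
have K0 z : (0 <= K z)%E by rewrite mule_ge0.
have absid (d : measure_display) (V : measurableType d)
    (m : {measure set V -> \bar R}) (G : V -> \bar R) :
    measurable_fun setT G -> (forall v, (0 <= G v)%E) ->
    (\int[m]_v G v = \int[pushforward m G]_(y in [set~ 0%E]) `|y|)%E.
  move=> mG G0; rewrite (ge0_integral_pushforward mG)//; last first.
    exact: measurableC.
  rewrite -[in RHS](setTI (_ @^-1` _)) integral_mkcondr/=.
  apply: eq_integral => v _; rewrite /patch; case: ifPn => /=.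
    by rewrite gee0_abs.
  by rewrite notin_setE /= => /contrapT.
rewrite (absid _ _ mu F)// (absid _ _ m2 K)//.
apply: eq_measure_integral => B mB B0.
rewrite -[LHS]/(mu (F @^-1` B)) -[RHS]/(m2 (K @^-1` B)).
rewrite FH//; last by move=> /B0; exact.
have mHB : measurable (H @^-1` B).
  by rewrite -[X in measurable X]setTI; exact: mH.
transitivity (\int[nu]_t ((\1_(H @^-1` B) t)%:E * (J t)%:E))%E.
  rewrite integral_mkcond; apply: eq_integral => t _.
  by rewrite patchE indicE; case: ifP => _; rewrite ?mul1e ?mul0e.
rewrite -integral_subgraph//; last first.
  by apply/measurable_EFinP; exact: measurable_indic.
have mKB : measurable (K @^-1` B).
  by rewrite -[X in measurable X]setTI; exact: mK.
transitivity (\int[m2]_z (\1_(K @^-1` B) z)%:E)%E; last first.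
  by rewrite integral_indic// setIT.
(* [K z] is [H z.1] on [U] and 0 off [U]; as 0 is not in [B], the preimage of [B] under [K] is the
   part of [U] lying above the preimage of [B] under [H]. *)
apply: eq_integral => z _; rewrite -EFinM; congr EFin.
have [Uz|Uz] := boolP (z \in U).
  rewrite [X in _ * X]indicE Uz mulr1 !indicE; congr (_ %:R).
  by congr nat_of_bool; apply/idP/idP;
    rewrite !inE /preimage/= /K indicE Uz mule1.
rewrite [X in _ * X]indicE (negbTE Uz) mulr0 indicE memNset//.
by rewrite /preimage/= /K indicE (negbTE Uz) mule0 => /B0; exact.
Qed.

Lemma measure_ae_eq {d} {T : measurableType d} {R : realType}
    (mu : {measure set T -> \bar R}) (A B : set T) :
  measurable A -> measurable B -> {ae mu, forall x, A x <-> B x} ->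
  mu A = mu B.
Proof.
move=> mA mB AB; rewrite -(setIT A) -(setIT B) -!integral_indic//.
apply: ge0_ae_eq_integral => //.
- by apply/measurable_EFinP; exact: measurable_indic.
- by apply/measurable_EFinP; exact: measurable_indic.
- by apply: filterS AB => x ABx _; rewrite !indicE;
    congr (_ %:R%:E); congr nat_of_bool; apply/idP/idP; rewrite !inE => /ABx.
Qed.

(** For [B] avoiding 0, the preimage of [B] under [F] agrees a.e. with the part of [D] that [g]
    sends into the preimage of [B] under [H], because [F] vanishes off [D]. That part may be
    nonmeasurable, so it is compared through the measurable representative given by
    [has_measure]. *)
Lemma integral_change_of_variables {d1 d2} {S : measurableType d1}
    {T : measurableType d2} {R : realType} (mu : {measure set S -> \bar R})
    (nu : {sigma_finite_measure set T -> \bar R}) (D : set S) (g : S -> T)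
    (J : T -> R) (F : S -> \bar R) (H : T -> \bar R) :
  measurable_fun setT J -> (forall t, 0 <= J t) ->
  measurable_fun setT F -> (forall x, (0 <= F x)%E) ->
  measurable_fun setT H -> (forall t, (0 <= H t)%E) ->
  (forall E, measurable E ->
    has_measure mu (D `&` g @^-1` E) (\int[nu]_(t in E) (J t)%:E)%E) ->
  {ae mu, forall x, (D x -> F x = H (g x)) /\ (~ D x -> F x = 0%E)} ->
  (\int[mu]_x F x = \int[nu]_t (H t * (J t)%:E))%E.
Proof.
move=> mJ J0 mF F0 mH H0 DgJ FH.
apply: integral_density_transfer => // B mB B0.
have mHB : measurable (H @^-1` B).
  by rewrite -[X in measurable X]setTI; exact: mH.
have mFB : measurable (F @^-1` B).
  by rewrite -[X in measurable X]setTI; exact: mF.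
have [A [mA AN <-]] := DgJ _ mHB.
apply: measure_ae_eq => //.
have {}AN : {ae mu, forall x, ~ ((D `&` g @^-1` (H @^-1` B)) `+` A) x}.
  by apply: negligibleS AN => x /= /contrapT.
apply: filterS2 FH AN => x [F1 F2]; rewrite /setY /= => /not_orP[NA1 NA2].
split.
  move=> FB; apply: contrapT => NAx; apply: NA1; split => //.
  have Dx : D x by apply: contrapT => /F2 Fx0; apply: B0; rewrite -Fx0.
  by split => //=; rewrite -F1.
move=> Ax; have [Dx HB] : (D `&` g @^-1` (H @^-1` B)) x.
  by apply: contrapT => h; apply: NA2.
by rewrite F1.
Qed.

(** By Tonelli, the measures of the sections of a measurable null cover integrate to 0, so almost
    every section of the cover is null. *)
Lemma negligible_xsection {d1 d2} {T1 : measurableType d1}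
    {T2 : measurableType d2} {R : realType} (m1 : {measure set T1 -> \bar R})
    (m2 : {sigma_finite_measure set T2 -> \bar R}) (P : T1 * T2 -> Prop) :
  {ae (m1 \x m2)%E, forall z, P z} ->
  {ae m1, forall x, {ae m2, forall t, P (x, t)}}.
Proof.
move=> [A [mA A0 PA]].
have mx := measurable_fun_xsection m2 mA.
have : (\int[m1]_x `|(m2 \o xsection A) x| = 0)%E.
  by under eq_integral do rewrite gee0_abs//.
move/(ae_eq_integral_abs m1 measurableT mx); apply: filterS => x /(_ I) Ax0.
exists (xsection A x); split => //; first exact: measurable_xsection.
by move=> t /PA; rewrite /xsection /= inE.
Qed.

(** * Iterated integrals *)

(** The numerator of the power put on the integral over [X k]: the exponent of the next integral
    outwards, or 1 for the outermost integral, which receives the power 1 / p_0. *)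
Definition outer_exponent {R : realType} (p : nat -> R) (k : nat) : R :=
  if k is l.+1 then p l else 1.

Section iterated_integral_theory.
Context {R : realType} (X : nat -> homogSpace R) (p : nat -> R).

(** One step of the recursion: on [initprod X k.+1], [iterated_integral p F] is by conversion
    [iterated_integral p (inner_integral F)], so inductions peel off the last coordinate. *)
Definition inner_integral k (F : initprod X k.+1 -> \bar R)
    (x : initprod X k) : \bar R :=
  poweR (\int[hs_measure (X k)]_t F (x, t))%E (outer_exponent p k / p k).

(* For a.e. x_0, for a.e. x_1, ..., for a.e. x_(k-1), [P] holds. For
   nonmeasurable [P] this is weaker than a.e. for the product measure. *)
Fixpoint iter_ae (k : nat) : (initprod X k -> Prop) -> Prop :=
  match k return (initprod X k -> Prop) -> Prop with
  | 0 => fun P => P tt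
  | j.+1 => fun P =>
      iter_ae (fun x : initprod X j =>
        {ae hs_measure (X j), forall t, P (x, t)})
  end.

Lemma iter_aeT k (P : initprod X k -> Prop) : (forall x, P x) -> iter_ae P.
Proof.
elim: k P => [|k IH] P Px; first exact: Px.
by apply: IH => x; apply: aeW => t; exact: Px.
Qed.

Lemma iter_aeS2 k (P Q S : initprod X k -> Prop) :
  (forall x, P x -> Q x -> S x) -> iter_ae P -> iter_ae Q -> iter_ae S.
Proof.
elim: k P Q S => [|k IH] P Q S PQS; first exact: PQS.
by apply: IH => x; apply: filterS2 => t; exact: PQS.
Qed.

Lemma iter_aeS k (P Q : initprod X k -> Prop) :
  (forall x, P x -> Q x) -> iter_ae P -> iter_ae Q.
Proof. by move=> PQ aP; apply: (iter_aeS2 _ aP aP) => x /PQ. Qed.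

Lemma ae_iter_ae k (P : initprod X k -> Prop) :
  {ae initprod_measure X k, forall x, P x} -> iter_ae P.
Proof.
elim: k P => [|k IH] P.
  move=> [A [mA A0 PA]] /=; apply: contrapT => /PA Att.
  by move: A0; rewrite /= diracE mem_set//= => /eqP; rewrite onee_eq0.
by move=> /negligible_xsection/IH.
Qed.

Lemma inner_integral_ge0 k (F : initprod X k.+1 -> \bar R) x :
  (0 <= inner_integral F x)%E.
Proof. exact: poweR_ge0. Qed.

Lemma measurable_section_integral k (F : initprod X k.+1 -> \bar R) :
  measurable_fun setT F -> (forall x, 0 <= F x)%E ->
  measurable_fun setT
    (fun x : initprod X k => \int[hs_measure (X k)]_t F (x, t))%E.
Proof. by move=> mF F0; exact: measurable_fun_fubini_tonelli_F. Qed.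

Lemma measurable_inner_integral k (F : initprod X k.+1 -> \bar R) :
  measurable_fun setT F -> (forall x, 0 <= F x)%E ->
  measurable_fun setT (inner_integral F).
Proof.
move=> mF F0; apply: (measurableT_comp (measurable_poweR _)).
exact: measurable_section_integral.
Qed.

Lemma measurable_xsection_fun k (F : initprod X k.+1 -> \bar R) x :
  measurable_fun setT F -> measurable_fun setT (fun t => F (x, t)).
Proof. by move=> mF; apply: (measurableT_comp mF); exact: pair1_measurable. Qed.

Lemma iterated_integral_ge0 k (F : initprod X k -> \bar R) :
  (forall x, 0 <= F x)%E -> (0 <= iterated_integral p F)%E.
Proof.
by elim: k F => [|k IH] F F0 /=; [exact: F0|apply: IH => x; exact: poweR_ge0].
Qed.

(** By induction the inner integral vanishes a.e., so almost every section of [F] is 0 a.e.; Tonelli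
    then makes the set where [F] is nonzero null for the product measure. *)
Lemma iterated_integral_eq0 k (F : initprod X k -> \bar R) :
  measurable_fun setT F -> (forall x, 0 <= F x)%E ->
  iterated_integral p F = 0%E -> {ae initprod_measure X k, forall x, F x = 0%E}.
Proof.
elim: k F => [|k IH] F mF F0 /= F_0.
  by apply: aeW => -[].
have {}F_0 : {ae initprod_measure X k, forall x, inner_integral F x = 0%E}.
  apply: IH => //; first exact: measurable_inner_integral.
  by move=> x; exact: inner_integral_ge0.
have mF0 : measurable (F @^-1` [set~ 0%E]).
  by rewrite -[X in measurable X]setTI; apply: mF => //; exact: measurableC.
exists (F @^-1` [set~ 0%E]); split => //.
rewrite /= /product_measure1.
rewrite -[RHS](@integral0 _ _ _ (initprod_measure X k) setT).
apply: ge0_ae_eq_integral => //; first exact: measurable_fun_xsection.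
apply: filterS F_0 => x /poweR_eq0_eq0 Fx _.
have {}Fx : (\int[hs_measure (X k)]_t `|F (x, t)| = 0)%E.
  by under eq_integral do rewrite gee0_abs//; apply: Fx; exact: integral_ge0.
have mFx := measurable_xsection_fun x mF.
move/(ae_eq_integral_abs _ measurableT mFx) : Fx => [A [mA A0 FA]].
apply: (@subset_measure0 _ _ _ _ _ A) => //; first exact: measurable_xsection.
by move=> t; rewrite /xsection /= inE => /= Ft; apply: FA => /= /(_ I).
Qed.

Section exponents.
Variable n : nat.
Hypothesis p_gt0 : forall i, (i < n)%N -> 0 < p i.

Lemma outer_exponent_gt0 k : (k <= n)%N -> 0 < outer_exponent p k.
Proof. by case: k => //= k kn; exact: p_gt0. Qed.

Lemma exponent_gt0 k : (k < n)%N -> 0 < outer_exponent p k / p k.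
Proof.
by move=> kn; rewrite divr_gt0 ?p_gt0// outer_exponent_gt0// ltnW.
Qed.

Lemma le_iterated_integral k (F G : initprod X k -> \bar R) : (k <= n)%N ->
  measurable_fun setT F -> measurable_fun setT G ->
  (forall x, 0 <= F x)%E -> (forall x, 0 <= G x)%E ->
  iter_ae (fun x => F x <= G x)%E ->
  (iterated_integral p F <= iterated_integral p G)%E.
Proof.
elim: k F G => [//|k IH] F G kn mF mG F0 G0 /= FG.
apply: (IH (inner_integral F) (inner_integral G)) => //.
- exact: ltnW.
- exact: measurable_inner_integral.
- exact: measurable_inner_integral.
- by move=> x; exact: inner_integral_ge0.
- by move=> x; exact: inner_integral_ge0.
apply: iter_aeS FG => x FGx.
rewrite /inner_integral gt0_ler_poweR ?(ltW (exponent_gt0 _))//.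
- by rewrite in_itv /= leey andbT integral_ge0.
- by rewrite in_itv /= leey andbT integral_ge0.
apply: ae_ge0_le_integral => //; [exact: measurable_xsection_fun..|].
by apply: filterS FGx => t.
Qed.

Lemma eq_iterated_integral k (F G : initprod X k -> \bar R) :
  F =1 G -> iterated_integral p F = iterated_integral p G.
Proof. by move=> /funext ->. Qed.

(** A factor c^(p_k) leaves the integral over [X k] and, under the power [outer_exponent p k / p k],
    becomes c^(outer_exponent p k), the right factor for the next integral outwards. At level 0 the
    exponent is 1. *)
Lemma iterated_integralZ k (c : R) (F : initprod X k -> \bar R) : (k <= n)%N ->
  0 <= c -> measurable_fun setT F -> (forall x, 0 <= F x)%E ->
  (iterated_integral p (fun x => (c `^ outer_exponent p k)%:E * F x)
   = c%:E * iterated_integral p F)%E.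
Proof.
elim: k F => [|k IH] F kn c0 mF F0 /=; first by rewrite powRr1.
rewrite -[in RHS]IH; last 4 first.
- exact: ltnW.
- by [].
- exact: measurable_inner_integral.
- by move=> x; exact: inner_integral_ge0.
apply: eq_iterated_integral => x.
rewrite ge0_integralZl//; last 2 first.
- exact: (measurable_xsection_fun x mF).
- by rewrite lee_fin powR_ge0.
rewrite poweRM ?lee_fin ?powR_ge0 ?integral_ge0//.
rewrite poweR_EFin -powRrM mulrCA divff ?mulr1//.
by rewrite gt_eqF// p_gt0.
Qed.

End exponents.

End iterated_integral_theory.

(** * The norm of a composition *)

Section segments.
Context {R : realType} (X : nat -> homogSpace R).

Lemma eq_segment (s s' : forall i, X i) k :
  (forall i, (i < k)%N -> s i = s' i) -> segment s k = segment s' k.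
Proof.
elim: k => //= k IH ss'; rewrite ss'// IH// => i ik.
by rewrite ss'// ltnW.
Qed.

Lemma segment_surj k (x : initprod X k) : exists s, segment s k = x.
Proof.
elim: k x => [|k IH] /= x.
  by exists (fun i => point : hs_metric (X i)); case: x.
have [s sx] := IH x.1; exists (dfwith s k x.2 : forall i, X i) => /=.
rewrite dfwithin (@eq_segment _ s) ?sx; first by case: x {sx}.
by move=> i ik; rewrite dfwithout// neq_ltn ik orbT.
Qed.

Lemma segments_full n (Omega : set (initprod X n)) : segments Omega n = Omega.
Proof.
apply/seteqP; split => [_ [s Os <-]//|x Ox].
by have [s sx] := segment_surj x; exists s => //=; rewrite sx.
Qed.

Lemma segments_prefix n (Omega : set (initprod X n)) k (x : initprod X k) t :
  segments Omega k.+1 (x, t) -> segments Omega k x.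
Proof. by move=> [s Os [<- _]]; exists s. Qed.

End segments.

Section norm_of_composition.
Context {R : realType} (X Y : nat -> homogSpace R) (p : nat -> R) (n : nat).
Variables (Omega : set (initprod X n)).
Variable psi : forall i, initprod X i -> X i -> Y i.
Arguments psi : clear implicits.

(** Equal images have equal earlier coordinates, so by induction the initial segments [x] coincide;
    then [psi k x], for this common [x], separates the last coordinates. *)
Lemma triangular_inj k :
  (forall i, (i < k)%N -> forall x : initprod X i,
    set_inj (fiber Omega x) (psi i x)) ->
  set_inj (segments Omega k) (triangular psi (k := k)).
Proof.
elim: k => [|k IH] psi_inj; first by move=> [] [].
move=> [x t] [x' t'] /= /set_mem xt /set_mem xt' [xx'].
have {}xx' : x = x'.
  apply: IH => //; first by move=> i ik; apply: psi_inj; exact: ltnW.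
  - by apply/mem_set; exact: segments_prefix xt.
  - by apply/mem_set; exact: segments_prefix xt'.
rewrite -{}xx' in xt' *.
by move=> tt'; congr pair; apply: (psi_inj k (ltnSn k) x) tt'; exact/mem_set.
Qed.

(** For a good initial segment [x], the bad last coordinates lie in the preimage under [psi k x] of
    a negligible set, which is negligible by the Luzin property of [psi k x]. *)
Lemma iter_ae_pullback k (Q : initprod Y k -> Prop) :
  (forall i, (i < k)%N -> iter_ae (fun x : initprod X i =>
      luzin_Ninv (hs_measure (X i)) (hs_measure (Y i))
        (fiber Omega x) (psi i x))) ->
  iter_ae Q ->
  iter_ae (fun x => segments Omega k x -> Q (triangular psi x)).
Proof.
elim: k Q => [|k IH] Q psiN //= aQ.
have {IH} := IH _ (fun i ik => psiN i (ltnW ik)) aQ.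
apply: iter_aeS2 (psiN k (ltnSn k)) => x Nx Qx.
have [sx|nsx] := pselect (segments Omega k x); last first.
  by apply: aeW => t /segments_prefix.
apply: negligibleS (Nx _ (Qx sx)) => t /= /not_implyP[xt nQ].
by split.
Qed.

Variable J : forall i, initprod Y i -> Y i -> R.
Arguments J : clear implicits.
Hypothesis psi_inj : forall i, (i.+1 < n)%N -> forall x : initprod X i,
  set_inj (fiber Omega x) (psi i x).
Hypothesis psi_Ninv : forall i, (i < n)%N ->
  iter_ae (fun x : initprod X i =>
    luzin_Ninv (hs_measure (X i)) (hs_measure (Y i))
      (fiber Omega x) (psi i x)).
Hypothesis J_RN : forall i, (i < n)%N -> is_RN_derivative psi Omega (J i).
Hypothesis p_gt0 : forall i, (i < n)%N -> 0 < p i.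

Let is_pullback k (F : initprod X k -> \bar R) (H : initprod Y k -> \bar R) :=
  iter_ae (fun x =>
    (segments Omega k x -> F x = H (triangular psi x)) /\
    (~ segments Omega k x -> F x = 0%E)).

(** By [triangular_inj], [x] is the only initial segment with image [triangular psi x]. Only maps of
    index below [k] are inverted here, so the last map may fail to be injective. *)
Lemma psi_invE k (x : initprod X k) E : (k < n)%N -> segments Omega k x ->
  psi_inv psi Omega (triangular psi x) E = fiber Omega x `&` psi k x @^-1` E.
Proof.
move=> kn sx; apply/seteqP; split => [t [x' [sx' xx' x't Et]]|t [xt Et]].
  suff xE : x' = x by rewrite xE in x't Et; split.
  apply: (@triangular_inj k) => //; [|exact/mem_set..].
  by move=> i ik; apply: psi_inj; exact: leq_ltn_trans kn.
by exists x; split.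
Qed.

Lemma measurable_weighted k (H : initprod Y k.+1 -> \bar R) : (k < n)%N ->
  measurable_fun setT H ->
  measurable_fun setT (fun y : initprod Y k.+1 => H y * (J k y.1 y.2)%:E)%E.
Proof.
move=> kn mH; apply: emeasurable_funM => //.
by apply/measurable_EFinP; have [] := J_RN kn.
Qed.

Lemma J_ge0 k y t : (k < n)%N -> 0 <= J k y t.
Proof. by move=> /J_RN[]. Qed.

Lemma weighted_ge0 k (H : initprod Y k.+1 -> \bar R) y : (k < n)%N ->
  (forall y, 0 <= H y)%E -> (0 <= H y * (J k y.1 y.2)%:E)%E.
Proof. by move=> kn H0; rewrite mule_ge0// lee_fin J_ge0. Qed.

Lemma is_pullback_inner k (F : initprod X k.+1 -> \bar R)
    (H : initprod Y k.+1 -> \bar R) : (k < n)%N ->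
  measurable_fun setT F -> measurable_fun setT H ->
  (forall x, 0 <= F x)%E -> (forall y, 0 <= H y)%E ->
  is_pullback F H ->
  is_pullback (inner_integral p F)
    (inner_integral p (fun y : initprod Y k.+1 => H y * (J k y.1 y.2)%:E)%E).
Proof.
move=> kn mF mH F0 H0; have [mJ J0 aeJ] := J_RN kn.
(* The Radon-Nikodym identity holds for a.e. [y]; it is needed at [y = triangular psi x], hence
   pulled back to the X side. *)
have /(iter_ae_pullback (fun i ik => psi_Ninv (ltn_trans ik kn))) :=
  ae_iter_ae aeJ.
apply: iter_aeS2 => x Jx FHx; split => [sx|nsx]; rewrite /inner_integral.
  congr poweR => /=.
  apply: (@integral_change_of_variables _ _ _ _ _ _ _
    (fiber Omega x) (psi k x)) => //.
  - exact: (measurableT_comp mJ (pair1_measurable (triangular psi x))).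
  - exact: (measurable_xsection_fun x mF).
  - exact: (measurable_xsection_fun (triangular psi x) mH).
  - by move=> E mE; rewrite -psi_invE//; exact: Jx.
(* No extension of [x] is an initial segment, as [x] is not one, so the section of [F] over [x]
   vanishes a.e. *)
rewrite (_ : \int[_]_t _ = 0)%E; last first.
  rewrite -[RHS](@integral0 _ _ _ (hs_measure (X k)) setT).
  apply: ge0_ae_eq_integral => //; first exact: (measurable_xsection_fun x mF).
  apply: filterS FHx => t [_ Ft] _; apply: Ft => /segments_prefix.
  exact: nsx.
by rewrite poweR0r// gt_eqF// (exponent_gt0 p_gt0).
Qed.

Lemma jacobian_prod_ge0 k (y : initprod Y k) : 0 <= jacobian_prod J p y.
Proof.
elim: k y => [|k IH] y //=.
by rewrite mulr_ge0// powR_ge0.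
Qed.

Lemma measurable_jacobian_prod k : (k <= n)%N ->
  measurable_fun setT (fun y : initprod Y k => jacobian_prod J p y).
Proof.
elim: k => [|k IH] kn //=; apply: measurable_funM.
  by apply: (measurableT_comp (IH _)); first exact: ltnW.
by apply: (measurableT_comp (measurable_powR _)); have [] := J_RN kn.
Qed.

(** Induction on [k], with [H] replaced by the inner integral of [H] times [J k]. The second
    hypothesis concerns only [k = 0] with [Omega] empty: then even the empty segment is missing, [F]
    is 0, and [H] has to be 0 too. *)
Lemma iterated_integral_pullback k (F : initprod X k -> \bar R)
    (H : initprod Y k -> \bar R) : (k <= n)%N ->
  (forall x, ~ segments Omega 0 x -> k = 0%N -> forall y, H y = 0%E) ->
  measurable_fun setT F -> measurable_fun setT H ->
  (forall x, 0 <= F x)%E -> (forall y, 0 <= H y)%E ->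
  is_pullback F H ->
  iterated_integral p F = iterated_integral p (fun y : initprod Y k =>
    H y * (jacobian_prod J p y `^ outer_exponent p k)%:E)%E.
Proof.
elim: k F H => [|k IH] F H kn Hout mF mH F0 H0 FH.
  rewrite /= powRr1// mule1; move: FH => /= [sF nsF].
  have [stt|nstt] := pselect (segments Omega 0 tt); first exact: sF.
  by rewrite nsF// (Hout _ nstt).
rewrite [LHS](IH (inner_integral p F)
  (inner_integral p (fun y : initprod Y k.+1 => H y * (J k y.1 y.2)%:E)%E)).
- apply: eq_iterated_integral => y.
  have pk0 : p k != 0 by rewrite gt_eqF// p_gt0.
  rewrite /inner_integral -[in RHS]/(outer_exponent p k).
  (* The power [p k] turns J_k^(1/p_k) back into J_k; the rest of the product is constant in [s],
     leaves the integral, and ends up with exponent [outer_exponent p k]. *)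
  transitivity (poweR (\int[hs_measure (Y k)]_s ((jacobian_prod J p y `^ p k)%:E
      * (H (y, s) * (J k y s)%:E)))%E (outer_exponent p k / p k)); last first.
    congr poweR; apply: eq_integral => s _ /=.
    rewrite powRM ?powR_ge0 ?jacobian_prod_ge0// -powRrM mulVf//.
    by rewrite powRr1 ?J_ge0// EFinM muleCA.
  rewrite ge0_integralZl//; last 3 first.
  - exact: (measurable_xsection_fun y (measurable_weighted kn mH)).
  - by move=> s _; exact: (weighted_ge0 (y, s)).
  - by rewrite lee_fin powR_ge0.
  rewrite [RHS]poweRM ?lee_fin ?powR_ge0 ?integral_ge0//; last first.
    by move=> s _; exact: (weighted_ge0 (y, s)).
  by rewrite poweR_EFin -powRrM mulrCA divff// mulr1 muleC.
- exact: ltnW.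
(* When [Omega] is empty, so is every [psi_inv], and [J 0] is a density of the zero measure.
   Changing variables with empty domain and zero integrand, for an arbitrary map [g], shows that the
   integral of [H] times [J 0] is 0. *)
- move=> x nsx k0 y; subst k.
  have [mJ J0 aeJ] := J_RN kn.
  have Jy := ae_iter_ae aeJ.
  pose g (_ : X 0) : Y 0 := (point : hs_metric (Y 0)).
  rewrite /inner_integral /=.
  rewrite -(@integral_change_of_variables _ _ _ _ _ (hs_measure (X 0)) _ set0
    g _ (cst 0%E)) //.
  - by rewrite integral0 poweR0r//; exact: lt0r_neq0 (exponent_gt0 p_gt0 kn).
  - exact: (measurableT_comp mJ (pair1_measurable y)).
  - exact: (@measurable_xsection_fun _ Y 0 H y mH).
  - move=> E mE; case: y; rewrite set0I.
    suff <- : psi_inv psi Omega (tt : initprod Y 0) E = set0 by exact: Jy.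
    apply/seteqP; split => // t [x' [sx' _ _ _]]; apply: nsx.
    by case: x sx'; case: x'.
  - by apply: aeW.
- exact: measurable_inner_integral.
- apply: measurable_inner_integral; first exact: measurable_weighted.
  by move=> y; exact: weighted_ge0.
- by move=> x; exact: inner_integral_ge0.
- by move=> x; exact: inner_integral_ge0.
- exact: is_pullback_inner.
Qed.

End norm_of_composition.

(** * Finite and positive norms *)

Section mixed_norm_theory.
Context {R : realType} (X : nat -> homogSpace R) (p : nat -> R) (n : nat).
Hypothesis n_gt0 : (0 < n)%N.
Hypothesis p_gt0 : forall i, (i < n)%N -> 0 < p i.

(** Written with [outer_exponent p n] instead of [p n.-1], which is the same for positive [n], so
    that the scaling and pullback lemmas apply directly. *)
Definition mixed_integrand (Omega : set (initprod X n)) (f : initprod X n -> R)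
    (x : initprod X n) : R :=
  `|f x| `^ outer_exponent p n * \1_Omega x.

Lemma mixed_normE (Omega : set (initprod X n)) f :
  mixed_norm p Omega f =
  iterated_integral p (fun x => (mixed_integrand Omega f x)%:E).
Proof. by rewrite /mixed_norm /mixed_integrand; case: n n_gt0 Omega f. Qed.

Lemma mixed_integrand_ge0 Omega f x : (0 <= (mixed_integrand Omega f x)%:E)%E.
Proof. by rewrite lee_fin mulr_ge0// powR_ge0. Qed.

Lemma measurable_mixed_integrand Omega f : measurable Omega ->
  measurable_fun Omega f ->
  measurable_fun setT (fun x => (mixed_integrand Omega f x)%:E).
Proof.
move=> mO mf; apply/measurable_EFinP.
have : measurable_fun Omega (fun x => `|f x| `^ outer_exponent p n).
  by apply: (measurableT_comp (measurable_powR _)); exact: measurableT_comp.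
move/(measurable_restrictT _ mO).1; apply: eq_measurable_fun => x _.
rewrite patchE /mixed_integrand indicE; case: ifP => _; rewrite ?mulr1 ?mulr0//.
Qed.

Lemma mixed_norm_ge0 (Omega : set (initprod X n)) f :
  (0 <= mixed_norm p Omega f)%E.
Proof.
rewrite mixed_normE; apply: iterated_integral_ge0 => x.
exact: mixed_integrand_ge0.
Qed.

(** Balls have positive measure by doubling. This excludes the essential supremum -oo that a null
    space would give. *)
Lemma initprod_measure_gt0 k : (0 < initprod_measure X k setT)%E.
Proof.
elim: k => [|k IH]; first by rewrite /= diracE mem_set.
have [c Hc] := hs_doubling (X k).
have [ball_gt0 _ _] := Hc point 1 ltr01.
rewrite /= -setXTT product_measure1E// mule_gt0//.
apply: lt_le_trans ball_gt0 _; rewrite le_measure ?inE//.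
exact: measurable_metric_ball.
Qed.

(** Products of balls that exhaust the space. The radii have the form [2 * r] because [hs_doubling]
    bounds the measure of such balls by a finite quantity. *)
Fixpoint box (m : nat) (k : nat) : set (initprod X k) :=
  match k return set (initprod X k) with
  | 0 => setT
  | j.+1 => @box m j `*`
      (ball (point : hs_metric (X j)) (2 * m.+1%:R) : set (X j))
  end.
Arguments box : clear implicits.

Lemma measurable_box m k : measurable (box m k).
Proof.
by elim: k => //= k IH; apply: measurableX => //; exact: measurable_metric_ball.
Qed.

Lemma le_box k m m' : (m <= m')%N -> box m k `<=` box m' k.
Proof.
move=> mm'; elim: k => //= k IH [x t] /= [xm tm]; split; first exact: IH.
move: tm; rewrite /= !ballEmdist /= => /lt_le_trans; apply.
by rewrite ler_pM2l// ler_nat.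
Qed.

Lemma bigcup_box k : \bigcup_m box m k = setT.
Proof.
apply/seteqP; split => // x _; elim: k x => [|k IH] x; first by exists 0%N.
have [m _ xm] := IH x.1.
pose m' := Num.truncn (mdist (point : hs_metric (X k)) x.2).
exists (maxn m m') => //=; split; first by apply: le_box xm; exact: leq_maxl.
rewrite /= ballEmdist /= (lt_le_trans (truncnS_gt _))//.
apply: (@le_trans _ _ (m'.+1%:R : R)); first by [].
apply: (@le_trans _ _ ((maxn m m').+1%:R : R)); last first.
  by rewrite ler_peMl// ler1n.
by rewrite ler_nat ltnS leq_maxr.
Qed.

Lemma iterated_integral_box_lty m k (c : R) : (k <= n)%N -> 0 <= c ->
  (iterated_integral p
     (fun x : initprod X k => (c * \1_(box m k) x)%:E) < +oo)%E.
Proof.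
elim: k c => [|k IH] c kn c0 /=; first by rewrite ltry.
have [C HC] := hs_doubling (X k).
pose B := ball (point : hs_metric (X k)) (2 * m.+1%:R) : set (X k).
have mB : measurable B by exact: measurable_metric_ball.
pose v := fine (hs_measure (X k) B).
have vE : hs_measure (X k) B = v%:E.
  have [_ h1 h2] := HC point m.+1%:R (ltr0Sn _ _).
  by rewrite fineK// ge0_fin_numE//; exact: le_lt_trans h1 h2.
have v0 : 0 <= v by rewrite fine_ge0.
pose q := outer_exponent p k / p k.
have q0 : 0 < q := exponent_gt0 p_gt0 kn.
have := IH ((c * v) `^ q) (ltnW kn) (powR_ge0 _ _).
congr (_ < _)%E; apply: eq_iterated_integral => x.
rewrite -[in RHS]/(outer_exponent p k) -/q.
transitivity (poweR (c * \1_(box m k) x * v)%:E q).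
  rewrite poweR_EFin; congr EFin; rewrite indicE.
  by case: (_ \in _); rewrite !(mulr1, mulr0, mul0r)// powR0// gt_eqF.
congr poweR; rewrite EFinM -vE -(setIT B) -integral_indic// -ge0_integralZl//.
- apply: eq_integral => t _; rewrite -EFinM; congr EFin.
  rewrite -mulrA; congr *%R; rewrite !indicE in_setX /=.
  by do 2 case: (_ \in _); rewrite ?(mulr0, mulr1).
- by apply/measurable_EFinP; exact: measurable_indic.
- by rewrite lee_fin mulr_ge0.
Qed.

End mixed_norm_theory.

Arguments box {R} X m k.

(** * The operator norm *)

Section operator_norm.
Context {R : realType} (X Y : nat -> homogSpace R) (p : nat -> R) (n : nat).
Hypothesis n_gt0 : (0 < n)%N.
Hypothesis p_gt0 : forall i, (i < n)%N -> 0 < p i.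
Variables (Omega : set (initprod X n)) (Omega' : set (initprod Y n)).
Hypothesis mOmega : measurable Omega.
Hypothesis mOmega' : measurable Omega'.
Variable psi : forall i, initprod X i -> X i -> Y i.
Arguments psi : clear implicits.
Let phi := triangular psi (k := n).
Hypothesis phi_maps : forall x, Omega x -> Omega' (phi x).
Hypothesis phi_meas : measurable_fun Omega phi.
Hypothesis psi_inj : forall i, (i.+1 < n)%N -> forall x : initprod X i,
  set_inj (fiber Omega x) (psi i x).
Hypothesis psi_Ninv : forall i, (i < n)%N ->
  {ae initprod_measure X i, forall x,
    luzin_Ninv (hs_measure (X i)) (hs_measure (Y i))
      (fiber Omega x) (psi i x)}.
Variable J : forall i, initprod Y i -> Y i -> R.
Arguments J : clear implicits.
Hypothesis J_RN : forall i, (i < n)%N -> is_RN_derivative psi Omega (J i).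

Local Notation Jp := (jacobian_prod J p (k := n)).
Local Notation M := (ess_sup_on (initprod_measure Y n) Omega' Jp).
Local Notation pn := (outer_exponent p n).

Let pn_gt0 : 0 < pn. Proof. exact: (outer_exponent_gt0 p_gt0 (leqnn n)). Qed.

Let Jp_ge0 y : 0 <= Jp y. Proof. exact: jacobian_prod_ge0. Qed.

Let mJp : measurable_fun setT Jp.
Proof. exact: (measurable_jacobian_prod p J_RN (leqnn n)). Qed.

Let measurable_comp_phi (f : initprod Y n -> R) :
  measurable_fun Omega' f -> measurable_fun Omega (f \o phi).
Proof.
move=> mf; apply: (measurable_comp mOmega' _ mf phi_meas).
by move=> _ [x Ox <-]; exact: phi_maps.
Qed.

Lemma mixed_norm_comp (f : initprod Y n -> R) : measurable_fun Omega' f ->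
  mixed_norm p Omega (f \o phi) = iterated_integral p (fun y =>
    (mixed_integrand p Omega' f y)%:E * (Jp y `^ pn)%:E)%E.
Proof.
move=> mf; rewrite mixed_normE//.
apply: (iterated_integral_pullback psi_inj _ J_RN p_gt0) => //.
- by move=> i /psi_Ninv/ae_iter_ae.
- by move=> _ _ n0; exfalso; move: n_gt0; rewrite n0.
- by apply: measurable_mixed_integrand => //; exact: measurable_comp_phi.
- exact: measurable_mixed_integrand.
- by move=> x; exact: mixed_integrand_ge0.
- by move=> x; exact: mixed_integrand_ge0.
apply: iter_aeT => x; rewrite segments_full /mixed_integrand; split => Ox.
  by rewrite !indicE !mem_set//; exact: phi_maps.
by rewrite indicE memNset// mulr0.
Qed.

Let measurable_jacobian_integrand (f : initprod Y n -> R) :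
  measurable_fun Omega' f ->
  measurable_fun setT (fun y =>
    (mixed_integrand p Omega' f y)%:E * (Jp y `^ pn)%:E)%E.
Proof.
move=> mf; apply: emeasurable_funM; first exact: measurable_mixed_integrand.
by apply/measurable_EFinP; apply: (measurableT_comp (measurable_powR _)).
Qed.

Lemma ess_sup_jacobian_ge0 : (0 <= M)%E.
Proof.
apply: ess_sup_gee; first exact: initprod_measure_gt0.
by apply: aeW => y; rewrite lee_fin mulr_ge0.
Qed.

(** [Jp] is at most M a.e. on [Omega'], and the constant M^pn inside the iterated integral comes out
    as M. *)
Lemma le_mixed_norm_comp (f : initprod Y n -> R) : measurable_fun Omega' f ->
  (M < +oo)%E -> (mixed_norm p Omega (f \o phi) <= M * mixed_norm p Omega' f)%E.
Proof.
move=> mf Moo; have M0 := ess_sup_jacobian_ge0.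
have ME : M = (fine M)%:E by rewrite fineK// ge0_fin_numE.
have m0 : 0 <= fine M by rewrite fine_ge0.
rewrite mixed_norm_comp// mixed_normE// ME.
rewrite -(iterated_integralZ p_gt0)//; last 2 first.
- exact: measurable_mixed_integrand.
- by move=> y; exact: mixed_integrand_ge0.
apply: (le_iterated_integral p_gt0) => //.
- exact: measurable_jacobian_integrand.
- by apply: emeasurable_funM => //; exact: measurable_mixed_integrand.
- by move=> y; rewrite mule_ge0 ?mixed_integrand_ge0// lee_fin powR_ge0.
- by move=> y; rewrite mule_ge0 ?mixed_integrand_ge0// lee_fin powR_ge0.
apply: ae_iter_ae; have := ess_sup_ge (initprod_measure Y n)
  (fun y => (Jp y * \1_Omega' y)%:E).
rewrite -/M ME; apply: filterS => y; rewrite !lee_fin /mixed_integrand indicE.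
case: (_ \in _); rewrite !(mulr1, mulr0, mul0r)//.
move=> JM; rewrite mulrC ler_wpM2r ?powR_ge0//.
by rewrite ge0_ler_powR ?nnegrE// ltW.
Qed.

(* The extremal functions are normalized indicators of [{Jp > c}], cut down to
   a box in order to have finite norm. *)
Lemma exists_norm_comp_ge (c : R) : 0 <= c -> (c%:E < M)%E ->
  exists f, [/\ mixed_Lp p Omega' f, mixed_norm p Omega' f = 1%E
    & (c%:E <= mixed_norm p Omega (f \o phi))%E].
Proof.
move=> c0 cM.
pose A := Omega' `&` [set y | c < Jp y].
have mA : measurable A.
  apply: measurableI => //.
  have := measurable_fun_ltr (measurable_cst c) mJp.
  by move=> /(_ measurableT [set true] I); rewrite setTI.
(* If [A] met every box in a negligible set, [A] would be negligible and [c] an essential upper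
   bound; off [Omega'] this uses that [c] is nonnegative. *)
have [m Am] : exists m, ~ (initprod_measure Y n).-negligible (A `&` box Y m n).
  apply/existsNP => An; move: cM; apply/negP; rewrite -leNgt.
  apply/ess_supP.
  have : (initprod_measure Y n).-negligible (\bigcup_m (A `&` box Y m n)).
    exact: negligible_bigcup.
  rewrite -setI_bigcupr bigcup_box setIT; apply: negligibleS => y /= /negP.
  rewrite lee_fin -ltNge indicE; have [/set_mem Oy|_] := boolP (_ \in _).
    by rewrite mulr1.
  by rewrite mulr0 ltNge c0.
pose B := A `&` box Y m n.
have mB : measurable B by apply: measurableI => //; exact: measurable_box.
pose N := iterated_integral p (fun y => (\1_B y : R)%:E).
have mI : measurable_fun setT (fun y => (\1_B y : R)%:E).
  by apply/measurable_EFinP; exact: measurable_indic.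
have I0 y : (0 <= (\1_B y : R)%:E)%E by rewrite lee_fin.
have N0 : (0 <= N)%E by exact: iterated_integral_ge0.
have Noo : (N < +oo)%E.
  apply: le_lt_trans (iterated_integral_box_lty Y p_gt0 m (leqnn n) ler01).
  apply: (le_iterated_integral p_gt0) => //.
  - apply/measurable_EFinP; apply: measurable_funM => //.
    by apply: measurable_indic; exact: measurable_box.
  apply: iter_aeT => y; rewrite lee_fin mul1r !indicE ler_nat.
  by case: (boolP (y \in B)) => // /set_mem[_ /mem_set ->].
have N_neq0 : N != 0%E.
  apply/eqP => /(iterated_integral_eq0 mI I0) NB; apply: Am.
  apply: negligibleS NB => y By /= /eqP; rewrite eqe indicE mem_set//.
  by rewrite oner_eq0.
have NE : N = (fine N)%:E by rewrite fineK// ge0_fin_numE.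
have v0 : 0 < fine N by rewrite fine_gt0// Noo lt0e N_neq0 N0.
(* No root of [N] is taken: the iterated integral already ends with the power 1 / p_0, and powers of
   an indicator are the indicator, so [N] is the mixed norm of the indicator of [B]. *)
pose f y := (fine N)^-1 * \1_B y.
have mf : measurable_fun Omega' f.
  by apply: measurable_funTS; apply: measurable_funM => //;
    exact: measurable_indic.
have fE y : mixed_integrand p Omega' f y = (fine N)^-1 `^ pn * \1_B y.
  rewrite /mixed_integrand /f !indicE.
  have [yB|_] := boolP (y \in B); last first.
    by rewrite !mulr0 normr0 powR0 ?mul0r// gt_eqF.
  have -> : y \in Omega' by move/set_mem : yB => [[/mem_set]].
  by rewrite !mulr1 ger0_norm// invr_ge0 ltW.
have f1 : mixed_norm p Omega' f = 1%E.
  rewrite mixed_normE//; under eq_iterated_integral do rewrite fE EFinM.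
  rewrite (iterated_integralZ p_gt0)//; last by rewrite invr_ge0 ltW.
  by rewrite -/N NE -EFinM mulVf// gt_eqF.
exists f; split => //; first by split => //; rewrite f1 ltry.
rewrite mixed_norm_comp//.
(* Write [c] as [c] times the norm of [f] and move it inside as c^pn, to be compared pointwise with
   Jp^pn on [B]. *)
rewrite -[leLHS]mule1 -[X in (_ * X <= _)%E]f1 mixed_normE//.
rewrite -(iterated_integralZ p_gt0)//; last 2 first.
- exact: measurable_mixed_integrand.
- by move=> y; exact: mixed_integrand_ge0.
apply: (le_iterated_integral p_gt0) => //.
- by apply: emeasurable_funM => //; exact: measurable_mixed_integrand.
- exact: measurable_jacobian_integrand.
- by move=> y; rewrite mule_ge0 ?mixed_integrand_ge0// lee_fin powR_ge0.
- by move=> y; rewrite mule_ge0 ?mixed_integrand_ge0// lee_fin powR_ge0.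
apply: iter_aeT => y; rewrite fE -!EFinM lee_fin indicE.
have [/set_mem[[_ /= cJ] _]|_] := boolP (y \in B); last first.
  by rewrite !(mulr0, mul0r).
rewrite mulr1 mulrC ler_wpM2l ?powR_ge0//.
by rewrite ge0_ler_powR ?nnegrE// ltW.
Qed.

Lemma bounded_compositionP :
  bounded_composition p Omega Omega' phi <-> (M < +oo)%E.
Proof.
have M0 := ess_sup_jacobian_ge0; split => [[K HK]|Moo].
  rewrite ltNge leye_eq; apply/negP => /eqP ME.
  (* A nonnegative constant larger than the supposed bound [K]. *)
  have [||f [Lf f1]] := exists_norm_comp_ge (c := `|K| + 1).
  - by rewrite addr_ge0.
  - by rewrite ME ltry.
  have [_] := HK f Lf; rewrite f1 mule1 => fK /le_trans /(_ fK).
  by apply/negP; rewrite lee_fin -ltNge (le_lt_trans (ler_norm K))// ltrDl.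
exists (fine M) => f [mf foo].
have ME : M = (fine M)%:E by rewrite fineK// ge0_fin_numE.
have le := le_mixed_norm_comp mf Moo; rewrite -ME; split => //; split.
  exact: measurable_comp_phi.
apply: le_lt_trans le _; rewrite ME lte_mul_pinfty//.
by rewrite lee_fin fine_ge0.
Qed.

Lemma composition_normE : (M < +oo)%E ->
  composition_norm p Omega Omega' phi = M.
Proof.
move=> Moo; have M0 := ess_sup_jacobian_ge0; apply/eqP.
rewrite eq_le; apply/andP; split.
  apply: ge_ereal_sup => _ [f [[mf _] f1] <-].
  apply: le_trans (le_mixed_norm_comp mf Moo) _.
  by rewrite -[leRHS]mule1 lee_wpmul2l.
pose s := composition_norm p Omega Omega' phi.
have le_s f : mixed_Lp p Omega' f -> (mixed_norm p Omega' f <= 1)%E ->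
    (mixed_norm p Omega (f \o phi) <= s)%E.
  by move=> Lf f1; apply: ereal_sup_ubound; exists f.
(* The zero function is admissible, so the supremum [s] is nonnegative; if it were below M it would
   be a real number. *)
have mf0 : measurable_fun Omega' (cst 0 : initprod Y n -> R) by [].
have f00 : mixed_norm p Omega' (cst 0) = 0%E.
  rewrite mixed_normE//.
  have := @iterated_integralZ _ Y _ _ p_gt0 n 0 _ (leqnn n) (lexx _)
    (measurable_mixed_integrand p mOmega' mf0)
    (fun y => mixed_integrand_ge0 p Omega' (cst 0) y).
  rewrite mul0e => E; rewrite -[RHS]E; apply: eq_iterated_integral => y.
  rewrite powR0 ?gt_eqF// mul0e /mixed_integrand normr0.
  by rewrite powR0 ?gt_eqF// mul0r.
have s0 : (0 <= s)%E.
  apply: le_trans (le_s (cst 0) _ _); first exact: mixed_norm_ge0.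
    by split => //; rewrite f00.
  by rewrite f00.
rewrite leNgt; apply/negP => sM.
have sE : s = (fine s)%:E by rewrite fineK// ge0_fin_numE// (lt_trans sM).
have ME : M = (fine M)%:E by rewrite fineK// ge0_fin_numE.
have sM' : fine s < fine M by rewrite -lte_fin -sE -ME.
(* The midpoint lies strictly between [s] and M, so the resulting function of norm 1 contradicts the
   definition of [s]. *)
have [||f [Lf f1]] := exists_norm_comp_ge (c := (fine s + fine M) / 2).
- by rewrite divr_ge0// addr_ge0// fine_ge0.
- by rewrite ME lte_fin midf_lt.
apply/negP; rewrite -ltNge; apply: le_lt_trans (le_s f Lf _) _.
  by rewrite f1.
by rewrite [ltLHS]sE lte_fin midf_lt.
Qed.

End operator_norm.

Theorem theorem3p1 (R : realType) (X Y : nat -> homogSpace R)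
  (n : nat) (hn : (0 < n)%N)
  (p : nat -> R) (hp : forall i, (i < n)%N -> 1 <= p i)
  (Omega : set (initprod X n)) (mOmega : measurable Omega)
  (Omega' : set (initprod Y n)) (mOmega' : measurable Omega')
  (psi : forall i, initprod X i -> X i -> Y i)
  (phi_maps : forall x, Omega x -> Omega' (triangular psi x))
  (phi_meas : measurable_fun Omega (triangular psi))
  (psi_inj : forall i, (i.+1 < n)%N -> forall x : initprod X i,
    set_inj (fiber Omega x) (psi i x))
  (psi_Ninv : forall i, (i < n)%N ->
    {ae initprod_measure X i, forall x,
      luzin_Ninv (hs_measure (X i)) (hs_measure (Y i))
        (fiber Omega x) (psi i x)})
  (J : forall i, initprod Y i -> Y i -> R)
  (J_RN : forall i, (i < n)%N -> is_RN_derivative psi Omega (J i)) :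
  (bounded_composition p Omega Omega' (triangular psi) <->
   (ess_sup_on (initprod_measure Y n) Omega' (jacobian_prod J p)
      < +oo)%E) /\
  (bounded_composition p Omega Omega' (triangular psi) ->
   composition_norm p Omega Omega' (triangular psi) =
   ess_sup_on (initprod_measure Y n) Omega' (jacobian_prod J p)).
Proof.
have p_gt0 i : (i < n)%N -> 0 < p i by move=> /hp; exact: lt_le_trans.
have bP := bounded_compositionP hn p_gt0 mOmega mOmega' phi_maps phi_meas
  psi_inj psi_Ninv J_RN.
split; first exact: bP.
move=> /bP; exact: (composition_normE hn p_gt0 mOmega mOmega' phi_maps phi_meas
  psi_inj psi_Ninv J_RN).
Qed.
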